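(* Let $G$ be a finite group. Then $|G|$ can be determined from the knowledge of $\Lambda^*(G)$; that is, if $G$ and $H$ are finite groups with $\Lambda^*(G)=\Lambda^*(H)$, then $|G|=|H|$.
   Context: For a finite group $G$ and non-negative integers $a\leq b$, $\Gamma_{a,b}(G)$ is the undirected graph, possibly with loops, whose vertices are the elements of $G^a\cup G^b$ (a disjoint union if $a\neq b$, just $G^a$ if $a=b$; $G^0$ consists of the single empty tuple), in which $(x_1,\dots,x_a)\in G^a$ and $(y_1,\dots,y_b)\in G^b$ are adjacent if and only if $\langle x_1,\dots,x_a,y_1,\dots,y_b\rangle=G$. If $a\neq b$ there are no other edges; if $a=b$ there is a loop at $x\in G^a$ exactly when the entries of $x$ generate $G$. A vertex is isolated if it is adjacent to no vertex (itself included). $\Gamma^*_{a,b}(G)$ is obtained from $\Gamma_{a,b}(G)$ by deleting the isolated vertices. $\Lambda^*(G)$ is the collection of all the connected components of the graphs $\Gamma^*_{a,b}(G)$, for all non-negative integers $a\leq b$, regarded as abstract graphs (with their loops) up to isomorphism and counted with multiplicity; the labels $a,b$ from which each graph arises are not part of the data. Thus $\Lambda^*(G)=\Lambda^*(H)$ means that there is a bijection between the two collections matching isomorphic graphs. *)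

(* Defs.v *)
From HB Require Import structures.
From mathcomp Require Import all_boot all_fingroup.

Set Implicit Arguments.
Unset Strict Implicit.
Unset Printing Implicit Defensive.

(* Finite undirected graphs, possibly with loops. *)
Record lgraph := LGraph {
  vertex :> finType;
  adj : rel vertex;
  adj_sym : symmetric adj
}.

Definition graph_iso (X Y : lgraph) : Prop :=
  exists2 f : X -> Y, bijective f & forall x y, adj (f x) (f y) = adj x y.

Section Subgraphs.

Variable X : lgraph.

Definition induced_adj (A : {set X}) : rel {x : X | x \in A} :=
  fun x y => adj (val x) (val y).

Lemma induced_adj_sym (A : {set X}) : symmetric (@induced_adj A).
Proof. by move=> x y; apply: adj_sym. Qed.

Definition induced (A : {set X}) : lgraph := LGraph (@induced_adj_sym A).

Definition isolated (x : X) : bool := [forall y, ~~ adj x y].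

Definition non_isolated : {set X} := [set x | ~~ isolated x].

Definition components : {set {set X}} :=
  equivalence_partition (connect (@adj X)) [set: X].

End Subgraphs.

Section GeneratingGraphs.

Variables (gT : finGroupType) (G : {group gT}) (a b : nat).

(* For a <= b, the sequences over G of length a or b form the union of G^a  *)
(* and G^b: it is disjoint when a != b and is just G^a when a = b. The type *)
(* of sequences of length at most b is used only to have a finType, so the  *)
(* definition is meaningful for a <= b only.                                *)
Definition Gamma_vertex : finType :=
  {x : b.-bseq gT | all [in G] x && (size x \in [:: a; b])}.

Definition Gamma_adj : rel Gamma_vertex := fun x y =>
  [|| (size (val x) == a) && (size (val y) == b)
    | (size (val x) == b) && (size (val y) == a)]
  && (<<[set g in val x ++ val y]>>%g == G :> {set gT}).

Lemma Gamma_adj_sym : symmetric Gamma_adj.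
Proof.
move=> x y; rewrite /Gamma_adj orbC ![(size (val x) == _) && _]andbC.
congr (_ && (<<_>>%g == _)).
by apply/setP=> g; rewrite !inE !mem_cat orbC.
Qed.

Definition Gamma : lgraph := LGraph Gamma_adj_sym.

Definition Gamma_star : lgraph := induced (non_isolated Gamma).

End GeneratingGraphs.

(* Lambda^*(G) is the family of graphs Lambda_graph i for i : Lambda_index G. *)
Record Lambda_index (gT : finGroupType) (G : {group gT}) := LambdaIndex {
  Lambda_a : nat;
  Lambda_b : nat;
  Lambda_le : Lambda_a <= Lambda_b;
  Lambda_comp : {set Gamma_star G Lambda_a Lambda_b};
  Lambda_compP : Lambda_comp \in components (Gamma_star G Lambda_a Lambda_b)
}.

Definition Lambda_graph (gT : finGroupType) (G : {group gT})
    (i : Lambda_index G) : lgraph :=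
  induced (Lambda_comp i).

(* Equality of the collections of graphs up to isomorphism, counted with *)
(* multiplicity.                                                         *)
Definition Lambda_eq (gT hT : finGroupType) (G : {group gT}) (H : {group hT})
    : Prop :=
  exists2 phi : Lambda_index G -> Lambda_index H, bijective phi &
    forall i, graph_iso (Lambda_graph i) (Lambda_graph (phi i)).

(* Main.v *)
Require Import Defs.
From mathcomp Require Import all_boot all_fingroup.

(** Let phi_G(b) be the number of generating b-tuples of G. For b > 0 the graph
    Gamma*_{0,b}(G) is empty or a star: its center is the empty tuple and its
    leaves are the phi_G(b) generating b-tuples. Conversely, when a > 0 no
    component of Gamma*_{a,b}(G) is a star with at least two leaves. Indeed let
    y be a leaf with neighbour x. For every entry g of y, multiplying the first
    entry of x by g gives another neighbour of y, which must be x itself, so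
    g = 1. Hence all leaves are tuples of 1s; being adjacent to the same center
    they have the same length, so there is only one of them. Consequently
    Lambda*(G) determines the set of the values phi_G(b) that exceed 1
    ([Lambda_star_ex], [Lambda_star], [Lambda_eq_phi]).

    These values determine |G| by their growth. Prefixing a generating tuple
    with any element keeps it generating, so |G| phi_G(b) <= phi_G(b+1), and
    |G|^k <= phi_G(|G| + k) <= |G|^(|G| + k). Suppose G is nontrivial. Then
    phi_G is strictly increasing from |G| on, and each value
    phi_G(|G| + k + 1) > 1 is a value of the nondecreasing function phi_H.
    Listing both increasingly gives phi_H(k) <= phi_G(|G| + k + 1), hence
    |H|^k <= |G|^(|G| + |H| + 1 + k) for all k, which forces |H| <= |G|
    ([Lambda_eq_leq]). Exchanging G and H gives equality. *)

Set Implicit Arguments.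
Unset Strict Implicit.
Unset Printing Implicit Defensive.

(** * Counting generating tuples *)

Section GeneratingTuples.

Variables (gT : finGroupType) (G : {group gT}).

Definition generates (s : seq gT) : bool :=
  all [in G] s && (<<[set g in s]>>%g == G :> {set gT}).

(** The Eulerian function of Hall. *)
Definition phi (b : nat) : nat := #|[set t : b.-tuple gT | generates t]|.

Lemma generates_catl s t : generates s -> all [in G] t -> generates (t ++ s).
Proof.
case/andP=> sG /eqP gen_s tG; rewrite /generates all_cat tG sG /=.
rewrite eqEsubset gen_subG; apply/andP; split.
  by apply/subsetP=> g; rewrite inE mem_cat => /orP[]; apply/allP.
rewrite -{1}gen_s genS //; apply/subsetP=> g.
by rewrite !inE mem_cat => ->; rewrite orbT.
Qed.

(** Prefixing a generating tuple with any element of [G] is injective and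
    yields generating tuples. *)
Lemma phi_geM b : #|G| * phi b <= phi b.+1.
Proof.
rewrite -cardsX.
have inj_cons : injective (fun p : gT * b.-tuple gT => cons_tuple p.1 p.2).
  move=> [g t] [h u] /(congr1 val) /= [-> tu]; congr (_, _).
  exact: val_inj.
rewrite -(card_imset _ inj_cons) subset_leq_card //.
apply/subsetP=> u /imsetP[[g t]]; rewrite !inE /= => /andP[gG gen_t] ->.
by apply: (@generates_catl t [:: g]) => //=; rewrite gG.
Qed.

Lemma phi_leX b : phi b <= #|G| ^ b.
Proof.
have inj_tnth : injective (fun t : b.-tuple gT => finfun (tnth t)).
  move=> t u /ffunP tu; apply: eq_from_tnth => j.
  by have:= tu j; rewrite !ffunE.
rewrite /phi -(card_imset _ inj_tnth) -[in leqRHS](card_ord b) -card_ffun_on.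
rewrite subset_leq_card //.
apply/subsetP=> u /imsetP[t]; rewrite !inE => /andP[/allP tG _] ->.
by apply/ffun_onP=> j; rewrite ffunE tG ?mem_tnth.
Qed.

Lemma phi_homo : {homo phi : b c / b <= c}.
Proof.
apply: homo_leq => // [c d e|b]; first exact: leq_trans.
by apply: leq_trans (phi_geM b); rewrite leq_pmull ?cardG_gt0.
Qed.

(** The enumeration of [G] is itself a generating tuple, of length [#|G|]. *)
Lemma phi_card_gt0 : 0 < phi #|G|.
Proof.
have szG : size (enum G) == #|G| by rewrite -cardE.
apply/card_gt0P; exists (Tuple szG); rewrite inE /generates /=.
apply/andP; split; first by apply/allP=> g; rewrite mem_enum.
apply/eqP/setP=> g; have -> : [set g in enum G] = G.
  by apply/setP=> h; rewrite inE mem_enum.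
by rewrite genGid.
Qed.

Lemma phi_geX k : #|G| ^ k <= phi (#|G| + k).
Proof.
elim: k => [|k IHk]; first by rewrite addn0 phi_card_gt0.
rewrite expnS addnS; apply: leq_trans (phi_geM _).
by rewrite leq_mul2l IHk orbT.
Qed.

Lemma phi_ltS k : 1 < #|G| -> phi (#|G| + k) < phi (#|G| + k).+1.
Proof.
move=> G_gt1; apply: leq_trans (phi_geM _).
rewrite ltn_Pmull //; apply: leq_trans (phi_geX k).
by rewrite expn_gt0 cardG_gt0.
Qed.

End GeneratingTuples.

(** If [g < h], the inequality of Bernoulli makes [(h / g) ^ k] at least
    [1 + k / g], so it is unbounded. *)
Lemma expn_bounded_leq g h c :
  0 < g -> (forall k, h ^ k <= g ^ (c + k)) -> h <= g.
Proof.
move=> g_gt0 le_hg; rewrite leqNgt; apply/negP=> lt_gh.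
(* This is 1 + k / g <= (h / g) ^ k with the denominators cleared. *)
have bernoulli k : g ^ k * (g + k) <= g * h ^ k.
  elim: k => [|k IHk]; first by rewrite !expn0 mul1n muln1 addn0.
  apply: (@leq_trans (g.+1 * (g * h ^ k))); last first.
    by rewrite expnS mulnCA leq_mul2l leq_mul2r lt_gh !orbT.
  apply: leq_trans (leq_mul (leqnn g.+1) IHk).
  rewrite expnS -mulnA mulnCA (mulnCA g.+1) leq_mul2l.
  by apply/orP; right; rewrite addnS mulnS mulSn leq_add2r leq_addr.
(* At k = g ^ c.+1 this would give g + g ^ c.+1 <= g ^ c.+1. *)
have := leq_trans (bernoulli (g ^ c.+1)) (leq_mul (leqnn g) (le_hg _)).
rewrite -expnS -addSn expnD mulnC leq_pmul2r ?expn_gt0 ?g_gt0 //.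
by rewrite leqNgt -{1}[g ^ _]add0n ltn_add2r g_gt0.
Qed.

(** * Stars among abstract graphs *)

Section Stars.

(** A star without loops. Its number of leaves is recorded separately, by the
    number of vertices, as both are invariant under isomorphism. *)
Definition star_center (X : lgraph) (c : X) : Prop :=
  forall x y : X, adj x y = (x == c) (+) (y == c).

Lemma star_center_iso (X Y : lgraph) (c : X) :
  graph_iso X Y -> star_center c -> exists d : Y, star_center d.
Proof.
case=> f f_bij f_adj star_c; exists (f c) => x y.
have [f' fK f'K] := f_bij.
by rewrite -{1}[x]f'K -{1}[y]f'K f_adj star_c !(can2_eq f'K fK).
Qed.

Lemma graph_iso_card (X Y : lgraph) : graph_iso X Y -> #|X| = #|Y|.
Proof. by case=> f f_bij _; apply: bij_eq_card f_bij. Qed.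

Lemma graph_iso_sym (X Y : lgraph) : graph_iso X Y -> graph_iso Y X.
Proof.
case=> f [f' fK f'K] f_adj; exists f'; first by exists f.
by move=> x y; rewrite -f_adj !f'K.
Qed.

End Stars.

(** * Components that are stars *)

Section LambdaGraphs.

Variables (gT : finGroupType) (G : {group gT}).
Implicit Type i : Lambda_index G.

(** The members of Lambda* are subgraphs of subgraphs of [Gamma]; working with
    the underlying vertices of [Gamma] avoids both layers of subtypes. *)
Definition Gamma_val i (x : Lambda_graph i) :
    Gamma G (Lambda_a i) (Lambda_b i) := val (val x).

Lemma Gamma_val_inj i : injective (@Gamma_val i).
Proof. by move=> x y /val_inj/val_inj. Qed.

Lemma Gamma_val_adj i (x y : Lambda_graph i) :
  adj x y = adj (Gamma_val x) (Gamma_val y).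
Proof. by []. Qed.

(** Neighbours in [Gamma] of a vertex of a component lie in that component:
    they are not isolated, and they are connected to the vertex. *)
Lemma Lambda_neighbour i (x : Lambda_graph i) z : adj (Gamma_val x) z ->
  exists2 z' : Lambda_graph i, Gamma_val z' = z & adj x z'.
Proof.
move=> adj_xz.
have z_ni : z \in non_isolated (Gamma G (Lambda_a i) (Lambda_b i)).
  rewrite inE negb_forall; apply/existsP; exists (Gamma_val x).
  by rewrite negbK adj_sym.
pose z1 : Gamma_star G (Lambda_a i) (Lambda_b i) := Sub z z_ni.
have z1_C : z1 \in Lambda_comp i.
  have [w _ defC] := imsetP (Lambda_compP i).
  have inC y : (y \in Lambda_comp i) = connect (@adj _) w y.
    by rewrite defC !inE.
  by rewrite inC (connect_trans (y := val x)) -?inC ?(valP x) ?connect1.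
by exists (Sub z1 z1_C).
Qed.

Lemma Lambda_neighbour_ex i (x : Lambda_graph i) :
  exists z, adj (Gamma_val x) z.
Proof.
have:= valP (val x); rewrite inE negb_forall => /existsP[z].
by rewrite negbK; exists z.
Qed.

Lemma Lambda_vertex_ex i : exists x : Lambda_graph i, true.
Proof.
have [w _ defC] := imsetP (Lambda_compP i).
have wC : w \in Lambda_comp i by rewrite defC inE inE connect0.
by exists (Sub w wC).
Qed.

Lemma nil_vertexP b : all [in G] ([bseq] : b.-bseq gT)
  && (size ([bseq] : b.-bseq gT) \in [:: 0; b]).
Proof. by []. Qed.

Definition nil_vertex b : Gamma G 0 b :=
  Sub ([bseq] : b.-bseq gT) (nil_vertexP b).

Lemma tuple_vertexP b (t : b.-tuple gT) : generates G t ->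
  all [in G] (bseq_of_tuple t) && (size (bseq_of_tuple t) \in [:: 0; b]).
Proof. by case/andP=> tG _; rewrite tG !inE size_tuple eqxx orbT. Qed.

Definition tuple_vertex b (t : b.-tuple gT) (gen_t : generates G t) :
  Gamma G 0 b := Sub (bseq_of_tuple t) (tuple_vertexP gen_t).

(** In Gamma_{0,b} with [0 < b], every edge joins the empty tuple to a
    generating [b]-tuple. So the empty tuple lies in every component, and with
    it all generating tuples: the component is unique and is a star. *)
Lemma Lambda_star_of_0 i : Lambda_a i = 0 -> 0 < Lambda_b i ->
  (exists c : Lambda_graph i, star_center c)
    /\ #|Lambda_graph i| = (phi G (Lambda_b i)).+1.
Proof.
(* The facts about the component used below are generalized together with its
   labels, so that the label a, on which types depend, can be replaced by 0. *)
move: (@Lambda_neighbour i) (@Lambda_neighbour_ex i) (Lambda_vertex_ex i).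
move: (@Gamma_val i) (@Gamma_val_inj i) (@Gamma_val_adj i).
move: (Lambda_graph i) => X.
move: (Lambda_a i) (Lambda_b i) => a b u u_inj u_adj lift ex_nb [x0 _] a0 b_gt0.
rewrite {}a0 {a} in u u_inj u_adj lift ex_nb *.
pose o := nil_vertex b.
pose L := [set y : Gamma G 0 b | (size (val y) == b) && generates G (val y)].
have size0 (y : Gamma G 0 b) : (size (val y) == 0) = (y == o).
  by apply/idP/eqP=> [/nilP y0 | -> //]; do 2!apply: val_inj.
have oL : o \notin L by rewrite inE /= eq_sym eqn0Ngt b_gt0.
have adjE (y z : Gamma G 0 b) :
    adj y z = (y == o) && (z \in L) || (z == o) && (y \in L).
  rewrite !inE /generates /= /Gamma_adj !size0.
  have /andP[-> _] := valP y; have /andP[-> _] := valP z => /=.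
  have [-> | yo] := eqVneq y o; have [-> | zo] := eqVneq z o => //=.
  - by rewrite andbT !orbb.
  - by rewrite andbF !orbF.
  - by rewrite cats0 andbT.
  - by rewrite andbF.
have [c cE] : exists c : X, u c = o.
  have [z] := ex_nb x0; rewrite adjE => adj_x0.
  have [x0o | /negPf x0o] := eqVneq (u x0) o; first by exists x0.
  move: (adj_x0); rewrite x0o /= => /andP[/eqP zo _].
  by have [|c cz _] := lift x0 z; [rewrite adjE | exists c; rewrite cz].
have imE : [set u x | x in X] = o |: L.
  apply/setP=> z; rewrite !inE; apply/imsetP/idP=> [[x _ ->] | ].
    have [z'] := ex_nb x; rewrite adjE.
    by rewrite orbC => /orP[] /andP[]; [rewrite inE orbC => _ -> | move=> ->].
  case/orP=> [/eqP-> | zL]; first by exists c.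
  have [|x <- _] := lift c z; last by exists x.
  by rewrite cE adjE eqxx inE zL.
have in_im x : u x \in o |: L by rewrite -imE imset_f.
split.
  exists c => x y; rewrite u_adj adjE -!(inj_eq u_inj) cE.
  move: (in_im x) (in_im y); rewrite !in_setU1.
  have [-> | _] := eqVneq (u x) o; have [-> | _] := eqVneq (u y) o;
    move=> /= x_im y_im; by rewrite ?x_im ?y_im ?(negPf oL).
transitivity #|o |: L|; first by rewrite -imE card_imset.
rewrite cardsU1 oL add1n; congr _.+1.
have val2_inj : injective (fun y : Gamma G 0 b => val (val y)).
  by move=> y z /val_inj/val_inj.
(* The default value is never reached on L, whose vertices have length b. *)
pose to_tuple (y : Gamma G 0 b) := insubd [tuple of nseq b 1%g] (val (val y)).
rewrite -(card_in_imset (f := to_tuple)); last first.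
  move=> y z; rewrite !inE => /andP[sy _] /andP[sz _] /(congr1 val).
  by rewrite !val_insubd sy sz => /val2_inj.
rewrite /phi; congr #|pred_of_set _|; apply/setP=> t; rewrite inE.
apply/imsetP/idP=> [[y + ->] | gen_t].
  by rewrite inE => /andP[sy gy]; rewrite val_insubd sy.
exists (tuple_vertex gen_t); first by rewrite inE /= size_tuple eqxx.
by apply: val_inj; rewrite val_insubd /= size_tuple eqxx.
Qed.

Lemma Lambda_star_ex b : 0 < b -> 0 < phi G b ->
  exists i : Lambda_index G,
    (exists c : Lambda_graph i, star_center c)
      /\ #|Lambda_graph i| = (phi G b).+1.
Proof.
move=> b_gt0 /card_gt0P[t]; rewrite inE => gen_t.
pose o := nil_vertex b.
have o_ni : o \in non_isolated (Gamma G 0 b).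
  rewrite inE negb_forall; apply/existsP; exists (tuple_vertex gen_t).
  by rewrite negbK /= /Gamma_adj /= size_tuple eqxx /=; case/andP: gen_t.
pose o1 : Gamma_star G 0 b := Sub o o_ni.
have CP : [set y in [set: Gamma_star G 0 b] | connect (@adj _) o1 y]
            \in components (Gamma_star G 0 b) by apply: imset_f.
by exists (LambdaIndex (leq0n b) CP); apply: Lambda_star_of_0.
Qed.

(** The length of a vertex forces that of its neighbours: the two lengths are
    [a] and [b] in some order. *)
Lemma size_neighbour a b (x y z : Gamma G a b) :
  adj x y -> adj x z -> size (val y) = size (val z).
Proof.
case/andP=> /orP xy _ /andP[/orP xz _].
by case: xy => /andP[/eqP x1 /eqP ->]; case: xz => /andP[/eqP x2 /eqP ->] //;
  apply: etrans (esym x2) x1.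
Qed.

(** Multiplying the first entry of the center [c] by an entry [g] of the leaf
    [y] does not change the subgroup generated by [c] and [y]. The result is
    thus a neighbour of [y], so it is [c], and [g = 1]. The hypothesis
    [0 < Lambda_a i] guarantees that [c] has a first entry. *)
Lemma star_leaf_trivial i (c y : Lambda_graph i) : 0 < Lambda_a i ->
  star_center c -> y != c ->
  val (Gamma_val y) = nseq (size (val (Gamma_val y))) 1%g :> seq gT.
Proof.
move=> a_gt0 star_c /negPf yc; apply/all_pred1P/allP=> g gy.
have b_gt0 := leq_trans a_gt0 (Lambda_le i).
have:= star_c c y; rewrite eqxx yc Gamma_val_adj adj_sym.
have yG h : h \in val (Gamma_val y) -> h \in G.
  by have /andP[/allP yG _] := valP (Gamma_val y); apply: yG.
move=> adj_yc.
have := valP (Gamma_val c); have := size_bseq (val (Gamma_val c)).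
case def_c: (bseqval (val (Gamma_val c))) => [|x w] /= sz_c.
  by rewrite !inE !(eq_sym 0) !eqn0Ngt a_gt0 b_gt0.
rewrite -andbA => /and3P[xG wG sz_in].
pose s := @Bseq (Lambda_b i) gT ((x * g)%g :: w) sz_c.
have sP : all [in G] s && (size s \in [:: Lambda_a i; Lambda_b i]).
  by rewrite /= (groupM xG (yG g gy)) sz_in andbT.
pose z : Gamma G (Lambda_a i) (Lambda_b i) := Sub s sP.
move: adj_yc; rewrite /= /Gamma_adj def_c => /andP[sz_yc].
rewrite eqEsubset => /andP[_ G_sub].
have adj_yz : adj (Gamma_val y) z.
  rewrite /= /Gamma_adj /= sz_yc /= eqEsubset; apply/andP; split.
    rewrite gen_subG; apply/subsetP=> h; rewrite inE mem_cat => /orP[/yG // | ].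
    by rewrite inE => /predU1P[-> | /(allP wG)//]; apply: groupM xG (yG g gy).
  apply: subset_trans G_sub _; rewrite gen_subG; apply/subsetP=> h.
  have memE k : k \in val (Gamma_val y) ++ (x * g)%g :: w ->
     k \in <<[set e in val (Gamma_val y) ++ (x * g)%g :: w]>>%g.
    by move=> k_in; apply: mem_gen; rewrite inE.
  rewrite inE mem_cat => /orP[hy | ].
    by apply: memE; rewrite mem_cat; apply/orP; left.
  rewrite inE => /predU1P[-> | hw].
    have g_in : g \in val (Gamma_val y) ++ (x * g)%g :: w.
      by rewrite mem_cat; apply/orP; left.
    have xg_in : (x * g)%g \in val (Gamma_val y) ++ (x * g)%g :: w.
      by rewrite mem_cat mem_head orbT.
    rewrite -[in X in X \in _](mulgK g x).
    exact: groupM (memE _ xg_in) (groupVr (memE _ g_in)).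
  by apply: memE; rewrite mem_cat; apply/orP; right; rewrite inE hw orbT.
have [z' z'E] := Lambda_neighbour adj_yz; rewrite star_c yc /= => /eqP z'c.
have /eqP: x = (x * g)%g.
  by move: def_c; rewrite -z'c z'E /= => -[].
by rewrite -{1}[x]mulg1 (inj_eq (mulgI x)) eq_sym.
Qed.

(** If [0 < a], two distinct leaves would be tuples of 1s of the same length;
    so [a = 0]. Then [b = 0] is impossible, because Gamma_{0,0} has a single
    vertex. *)
Lemma Lambda_star i (c : Lambda_graph i) :
  star_center c -> 2 < #|Lambda_graph i| ->
  exists b, #|Lambda_graph i| = (phi G b).+1.
Proof.
move=> star_c gt2.
have [y1 [y2 [yc1 yc2 y12]]] : exists y1 y2, [/\ y1 != c, y2 != c & y1 != y2].
  have : 1 < #|[set~ c]| by rewrite cardsC1 -subn1 ltn_subRL.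
  by case/card_gt1P=> y1 [y2 []]; rewrite !inE; exists y1, y2.
have sz12 : size (val (Gamma_val y1)) = size (val (Gamma_val y2)).
  apply: (@size_neighbour (Lambda_a i) (Lambda_b i) (Gamma_val c)).
    by rewrite -Gamma_val_adj star_c eqxx (negPf yc1).
  by rewrite -Gamma_val_adj star_c eqxx (negPf yc2).
have [a0 | a_gt0] := posnP (Lambda_a i); last first.
  case/eqP: y12; apply/Gamma_val_inj/val_inj/val_inj.
  apply: etrans (star_leaf_trivial a_gt0 star_c yc1) _; rewrite sz12.
  exact: esym (star_leaf_trivial a_gt0 star_c yc2).
have [b0 | b_gt0] := posnP (Lambda_b i); last first.
  by have [_ ->] := Lambda_star_of_0 a0 b_gt0; exists (Lambda_b i).
case/eqP: y12; apply/Gamma_val_inj/val_inj/val_inj.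
have sz0 (y : Lambda_graph i) : val (Gamma_val y) = [::] :> seq gT.
  apply/nilP; have /andP[_] := valP (Gamma_val y).
  rewrite !inE => /orP[] /eqP sz_y; apply/eqP; last exact: etrans sz_y b0.
  exact: etrans sz_y a0.
exact: etrans (sz0 y1) (esym (sz0 y2)).
Qed.

End LambdaGraphs.

(** * Recovering the order *)

Lemma Lambda_eq_sym (gT hT : finGroupType) (G : {group gT}) (H : {group hT}) :
  Lambda_eq G H -> Lambda_eq H G.
Proof.
case=> f [f' fK f'K] f_iso; exists f'; first by exists f.
by move=> i; apply: graph_iso_sym; rewrite -{2}[i]f'K.
Qed.

Lemma Lambda_eq_phi (gT hT : finGroupType) (G : {group gT}) (H : {group hT}) b :
  Lambda_eq G H -> 0 < b -> 1 < phi G b -> exists c, phi G b = phi H c.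
Proof.
case=> f _ f_iso b_gt0 phi_gt1.
have [i [[c star_c] sz_i]] := Lambda_star_ex b_gt0 (ltnW phi_gt1).
have [d star_d] := star_center_iso (f_iso i) star_c.
have sz_fi := graph_iso_card (f_iso i); rewrite sz_i in sz_fi.
have [|e] := Lambda_star star_d; first by rewrite -sz_fi.
by rewrite -sz_fi => -[]; exists e.
Qed.

(** The values of [phi G] at the indices [#|G| + k.+1] strictly increase and
    are values of the nondecreasing [phi H]; the index in [H] of the [k]-th one
    is at least [k], so [phi H] grows no faster than [phi G]. The conclusion
    [1 < #|H|] lets the argument be repeated with [G] and [H] exchanged. *)
Lemma Lambda_eq_leq (gT hT : finGroupType) (G : {group gT}) (H : {group hT}) :
  Lambda_eq G H -> 1 < #|G| -> 1 < #|H| <= #|G|.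
Proof.
move=> eqGH G_gt1.
have phi_gt1 k : 1 < phi G (#|G| + k.+1).
  rewrite addnS; apply: leq_ltn_trans (phi_ltS k G_gt1).
  by apply: leq_trans (phi_geX G k); rewrite expn_gt0 cardG_gt0.
have phiH k : exists c, phi G (#|G| + k.+1) = phi H c.
  by apply: Lambda_eq_phi => //; rewrite addnS.
have le_index k c : phi G (#|G| + k.+1) = phi H c -> k <= c.
  elim: k c => // k IHk c eq_c; have [d eq_d] := phiH k.
  apply: leq_ltn_trans (IHk d eq_d) _; rewrite ltnNge; apply/negP=> le_cd.
  have:= phi_homo H le_cd; rewrite -eq_c -eq_d leqNgt.
  by rewrite [_ + k.+2]addnS phi_ltS.
have phiHG k : phi H k <= phi G (#|G| + k.+1).
  have [c eq_c] := phiH k; rewrite eq_c; apply: phi_homo; exact: le_index.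
apply/andP; split.
  have [c eq_c] := phiH 0; rewrite ltnNge; apply/negP=> H_le1.
  have:= leq_trans (phi_gt1 0) (eq_leq eq_c).
  rewrite ltnNge (leq_trans (phi_leX H c)) //.
  by have /eqP-> : #|H| == 1; rewrite ?exp1n // eqn_leq H_le1 cardG_gt0.
apply: (@expn_bounded_leq _ _ (#|G| + #|H|.+1)) => [|k]; first exact: cardG_gt0.
apply: leq_trans (phi_geX H k) _; apply: leq_trans (phiHG _) _.
by apply: leq_trans (phi_leX G _) _; rewrite -addSn addnA.
Qed.

Theorem proposition5p12 (gT hT : finGroupType)
    (G : {group gT}) (H : {group hT}) :
  Lambda_eq G H -> #|G| = #|H|.
Proof.
move=> eqGH; have eqHG := Lambda_eq_sym eqGH.
have [G_gt1 | G_le1] := ltnP 1 #|G|.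
  have /andP[H_gt1 le_HG] := Lambda_eq_leq eqGH G_gt1.
  have /andP[_ le_GH] := Lambda_eq_leq eqHG H_gt1.
  by apply/eqP; rewrite eqn_leq le_GH.
have [H_gt1 | H_le1] := ltnP 1 #|H|.
  by have /andP[] := Lambda_eq_leq eqHG H_gt1; rewrite ltnNge G_le1.
have /eqP-> : #|G| == 1 by rewrite eqn_leq G_le1 cardG_gt0.
by apply/esym/eqP; rewrite eqn_leq H_le1 cardG_gt0.
Qed.
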